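(* There exists an absolute constant $C>0$ such that for every integer $p\ge 1$, every graph $G=(V,E,\ell)$ of treewidth $p$ with nonnegative edge lengths, and every set $R\subseteq V$ of $k$ terminals, $G$ admits a distance-preserving minor $G'=(V',E',\ell')$ with respect to $R$ with $|V'|\le C p^3 k$. In other words, $f^*(k,\mathrm{TW}(p))\le Cp^3k$, where $\mathrm{TW}(p)$ is the family of graphs of treewidth at most $p$.
   Context: $d_H$ denotes shortest-path distance in a graph $H$ with respect to its edge lengths. Given a graph $G=(V,E,\ell)$ and terminals $R\subseteq V$, a distance-preserving minor of $G$ with respect to $R$ is a graph $G'$ with edge lengths $\ell'$ (which may differ from $\ell$) such that $G'$ is a minor of $G$ in which the terminals survive (terminals are never deleted and no two terminals are merged; a terminal may be merged with non-terminals by contraction and the resulting vertex is identified with that terminal), so $R\subseteq V(G')$, and $d_{G'}(u,v)=d_G(u,v)$ for all $u,v\in R$. For a family $\mathcal{F}$ of graphs, $f^*(k,\mathcal{F})$ is the minimum number such that every graph in $\mathcal{F}$, with any nonnegative edge lengths and any $k$ terminals, admits a distance-preserving minor with at most $f^*(k,\mathcal{F})$ vertices. *)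

(* Defs.v *)
From HB Require Import structures.
From mathcomp Require Import all_boot all_order all_algebra.
From mathcomp Require Import all_classical all_reals ereal.

Set Implicit Arguments.
Unset Strict Implicit.
Unset Printing Implicit Defensive.

Import Order.TTheory GRing.Theory Num.Theory.
Local Open Scope ring_scope.

(* Finite simple undirected graphs. The vertex set is a subset of an ambient
   finite type, so that a graph and its minors share the same vertex names and
   the terminals of a graph are literally vertices of its minors. *)
Record sgraph (V : finType) := SGraph {
  verts : {set V};
  adj : rel V;
  adj_sym : symmetric adj;
  adj_irrefl : irreflexive adj;
  adj_verts : forall x y, adj x y -> x \in verts
}.

Section Operations.
Variables (V : finType) (G : sgraph V).

Definition del_vertex_adj (v : V) : rel V :=
  fun a b => [&& adj G a b, a != v & b != v].

Lemma del_vertex_sym v : symmetric (del_vertex_adj v).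
Proof. by move=> a b; rewrite /del_vertex_adj adj_sym [(a != v) && _]andbC. Qed.

Lemma del_vertex_irrefl v : irreflexive (del_vertex_adj v).
Proof. by move=> a; rewrite /del_vertex_adj adj_irrefl. Qed.

Lemma del_vertex_verts v a b : del_vertex_adj v a b -> a \in verts G :\ v.
Proof. by case/and3P=> /adj_verts aG av _; rewrite in_setD1 av. Qed.

Definition del_vertex (v : V) : sgraph V :=
  SGraph (@del_vertex_sym v) (@del_vertex_irrefl v) (@del_vertex_verts v).

Definition del_edge_adj (x y : V) : rel V :=
  fun a b => adj G a b && ([set a; b] != [set x; y]).

Lemma del_edge_sym x y : symmetric (del_edge_adj x y).
Proof. by move=> a b; rewrite /del_edge_adj adj_sym finset.setUC. Qed.

Lemma del_edge_irrefl x y : irreflexive (del_edge_adj x y).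
Proof. by move=> a; rewrite /del_edge_adj adj_irrefl. Qed.

Lemma del_edge_verts x y a b : del_edge_adj x y a b -> a \in verts G.
Proof. by case/andP=> /adj_verts. Qed.

Definition del_edge (x y : V) : sgraph V :=
  SGraph (@del_edge_sym x y) (@del_edge_irrefl x y) (@del_edge_verts x y).

(* Contraction of the edge xy; the resulting vertex keeps the name x. *)
Definition contract_adj (x y : V) : rel V :=
  fun a b =>
    [&& a \in verts G :\ y, b \in verts G :\ y, a != b &
        [|| adj G a b, (a == x) && adj G y b | (b == x) && adj G a y]].

Lemma contract_sym x y : symmetric (contract_adj x y).
Proof.
move=> a b; rewrite /contract_adj andbCA [b == a]eq_sym [adj G b a]adj_sym.
by rewrite [adj G b y]adj_sym [adj G a y]adj_sym [X in _ || X]orbC.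
Qed.

Lemma contract_irrefl x y : irreflexive (contract_adj x y).
Proof. by move=> a; rewrite /contract_adj eqxx !andbF. Qed.

Lemma contract_verts x y a b : contract_adj x y a b -> a \in verts G :\ y.
Proof. by case/and4P. Qed.

Definition contract (x y : V) : sgraph V :=
  SGraph (@contract_sym x y) (@contract_irrefl x y) (@contract_verts x y).

End Operations.

(* [minor_wrt S G H]: H arises from G by deletions and contractions in which
   the terminals S survive. As [contract H x y] discards the name y, the side
   condition [y \notin S] both forbids merging two terminals and identifies
   the merged vertex with the terminal among x, y, if any. *)
Inductive minor_wrt (V : finType) (S : {set V}) (G : sgraph V) :
    sgraph V -> Prop :=
| minor_refl : minor_wrt S G G
| minor_del_vertex H v :
    minor_wrt S G H -> v \notin S -> minor_wrt S G (del_vertex H v)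
| minor_del_edge H x y :
    minor_wrt S G H -> minor_wrt S G (del_edge H x y)
| minor_contract H x y :
    minor_wrt S G H -> adj H x y -> y \notin S ->
    minor_wrt S G (contract H x y).

Section Distance.
Variables (R : realType) (V : finType).
Implicit Types (G : sgraph V) (ell : V -> V -> R).

(* Only the values of ell on edges matter. *)
Definition edge_lengths G ell : Prop :=
  forall x y, adj G x y -> ell x y = ell y x /\ 0 <= ell x y.

Fixpoint path_length ell (x : V) (s : seq V) : R :=
  if s is y :: s' then ell x y + path_length ell y s' else 0.

Definition simple_path G (u v : V) (s : seq V) : Prop :=
  [/\ path (adj G) u s, uniq (u :: s) & last u s = v].

(* There are finitely many simple paths, so the infimum is a minimum, except
   that it is +oo when v is not reachable from u. *)
Definition dist G ell (u v : V) : \bar R :=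
  ereal_inf [set (path_length ell u s)%:E | s in simple_path G u v]%classic.

Definition distance_preserving_minor (S : {set V}) G ell G' ell' : Prop :=
  [/\ minor_wrt S G G', edge_lengths G' ell' &
      forall u v, u \in S -> v \in S -> dist G' ell' u v = dist G ell u v].

End Distance.

Section Treewidth.

Definition connected_on (I : finType) (e : rel I) (A : {set I}) : Prop :=
  forall i j, i \in A -> j \in A ->
    connect (fun a b => [&& a \in A, b \in A & e a b]) i j.

Definition acyclic (I : finType) (e : rel I) : Prop :=
  forall s : seq I, (2 < size s)%N -> ~ ucycle e s.

Definition is_tree (I : finType) (T : sgraph I) : Prop :=
  [/\ verts T != finset.set0, connected_on (adj T) (verts T) & acyclic (adj T)].

Record tree_decomposition (V : finType) (G : sgraph V)
    (I : finType) (T : sgraph I) (B : I -> {set V}) : Prop := {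
  td_tree : is_tree T;
  td_bags : forall i, i \in verts T -> B i \subset verts G;
  td_verts : forall x, x \in verts G -> exists2 i, i \in verts T & x \in B i;
  td_edges : forall x y, adj G x y ->
    exists2 i, i \in verts T & (x \in B i) && (y \in B i);
  td_subtrees : forall x, x \in verts G ->
    connected_on (adj T) [set i in verts T | x \in B i]
}.

(* Truncated: the width of a decomposition with only empty bags is 0 here. *)
Definition width (V I : finType) (T : sgraph I) (B : I -> {set V}) : nat :=
  (\max_(i in verts T) #|B i|).-1.

Definition has_decomposition_of_width (V : finType) (G : sgraph V) (w : nat) :=
  exists (I : finType) (T : sgraph I) (B : I -> {set V}),
    tree_decomposition G T B /\ width T B = w.

Definition is_treewidth (V : finType) (G : sgraph V) (p : nat) : Prop :=
  has_decomposition_of_width G p /\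
  forall q, has_decomposition_of_width G q -> (p <= q)%N.

End Treewidth.

Definition graph_family := forall V : finType, sgraph V -> Prop.

Definition TW (p : nat) : graph_family :=
  fun V G => exists2 q, is_treewidth G q & (q <= p)%N.

Definition dpm_bound (R : realType) (k : nat) (F : graph_family) (n : nat) :=
  forall (V : finType) (G : sgraph V) (ell : V -> V -> R) (S : {set V}),
    F V G -> edge_lengths G ell -> S \subset verts G -> #|S| = k ->
    exists (G' : sgraph V) (ell' : V -> V -> R),
      distance_preserving_minor S G ell G' ell' /\ (#|verts G'| <= n)%N.

Definition is_fstar (R : realType) (k : nat) (F : graph_family) (n : nat) :=
  dpm_bound R k F n /\ forall m, dpm_bound R k F m -> (n <= m)%N.

(* Main.v *)
Require Import Defs.
From mathcomp Require Import all_boot all_order all_algebra.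
From mathcomp Require Import all_classical all_reals ereal.
From mathcomp Require Import zify lra.
Set Implicit Arguments.
Unset Strict Implicit.
Unset Printing Implicit Defensive.
Import Order.TTheory GRing.Theory Num.Theory.
Local Open Scope ring_scope.

(* Call a vertex of degree at least 3 branching. If no edge of a graph can be
   removed without increasing a distance between terminals, every edge is
   essential for some pair of terminals, and a branching vertex lies on the
   shortest paths of two pairs while one of its edges is essential for the first
   pair and missed by the path of the second. Each two pairs allow at most two
   such vertices, so k terminals leave O(k^4) branching vertices.

   For bags of size at most w = p + 1 and k >= 4w terminals, a tree decomposition
   provides a separation (A, C) of order at most w with between 3w and 6w
   terminals in A \ C. Making A :&: C terminals, side A has O(w) terminals, hence
   can be sparsified to O(w^4) branching vertices, and side C has at most k - 2w
   terminals; recursing on C leaves O(w^3 k) branching vertices in total.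

   Finally nonterminals of degree at most 2 are deleted or contracted. *)

(** * Walks and distances *)

Section Walks.
Variables (R : realType) (V : finType).
Implicit Types (e f g : rel V) (l : V -> V -> R) (x y z u v : V) (s t : seq V).

Definition walk e x y s := path e x s && (last x s == y).

Lemma path_length_cat l x s t :
  path_length l x (s ++ t) = path_length l x s + path_length l (last x s) t.
Proof. by elim: s x => [|y s IH] x /=; rewrite ?add0r // IH addrA. Qed.

Lemma path_length_ge0 e l x s :
  (forall a b, e a b -> 0 <= l a b) -> path e x s -> 0 <= path_length l x s.
Proof.
move=> l0; elim: s x => [|y s IH] x //= /andP[exy /IH]; apply: addr_ge0.
exact: l0.
Qed.

Lemma walk_cat e x y z s t : walk e x y s -> walk e y z t -> walk e x z (s ++ t).
Proof.
by case/andP=> ps /eqP<- /andP[pt /eqP<-]; rewrite /walk cat_path last_cat ps pt /=.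
Qed.

Lemma sub_walk e f x y s : subrel e f -> walk e x y s -> walk f x y s.
Proof. by move=> ef /andP[p e1]; rewrite /walk e1 (sub_path ef). Qed.

Lemma walk_rev e l x y s : symmetric e -> (forall a b, l a b = l b a) ->
  walk e x y s ->
  exists2 t, walk e y x t & path_length l y t = path_length l x s.
Proof.
move=> se sl; elim: s x => [|z s IH] x.
  by case/andP=> _ /= /eqP->; exists [::]; rewrite // /walk /= eqxx.
case/andP=> /= /andP[exz ps] lst; have [|t wt lt] := IH z; first exact/andP.
exists (t ++ [:: x]).
  by apply: (walk_cat wt); rewrite /walk /= se exz eqxx.
rewrite path_length_cat lt addrC /= addr0; congr (_ + _).
by case/andP: wt => _ /eqP->.
Qed.

(** By induction on the walk: if the first vertex reappears in the simplified tail, the closed part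
    before that visit is dropped. It has nonnegative length. *)
Lemma walk_simple e l x y s : (forall a b, e a b -> 0 <= l a b) ->
  walk e x y s ->
  exists t, [/\ walk e x y t, uniq (x :: t) &
    path_length l x t <= path_length l x s].
Proof.
move=> l0; elim: s x => [|z s IH] x; first by move=> w; exists [::].
case/andP=> /= /andP[exz ps] lst; have [|t [wt ut lt]] := IH z; first exact/andP.
have [xt|xt] := boolP (x \in z :: t); last first.
  exists (z :: t); split; last by rewrite /= lerD2l.
    by case/andP: wt => pt lt'; rewrite /walk /= exz pt.
  by rewrite cons_uniq xt.
case/splitPl: xt ut wt lt => t1 t2 l1 ut /andP[pt lt] le.
exists t2; split.
- move: pt lt; rewrite /walk cat_path last_cat l1 => /andP[_ ->].
  by move=> /eqP->; rewrite eqxx.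
- move: ut; rewrite -cat_cons lastI cat_rcons l1 cat_uniq.
  by case/and3P.
- move: le; rewrite path_length_cat l1 /=.
  move: pt; rewrite cat_path => /andP[/(path_length_ge0 l0) + _].
  by have := l0 _ _ exz; lra.
Qed.

(** One-sided comparison of terminal distances through walks: it composes, avoids infima, and asks
    nothing of disconnected pairs. *)
Definition dominated (S : {set V}) e l f l' := forall u v s,
  u \in S -> v \in S -> walk e u v s ->
  exists2 t, walk f u v t & path_length l' u t <= path_length l u s.

Lemma dominated_trans (S : {set V}) e l f l' g l'' :
  dominated S e l f l' -> dominated S f l' g l'' -> dominated S e l g l''.
Proof.
move=> ef fg u v s uS vS /(ef u v s uS vS)[t /(fg u v t uS vS)[t' w le'] le].
by exists t' => //; exact: le_trans le.
Qed.

Lemma sub_dominated (S : {set V}) e f l : subrel e f -> dominated S e l f l.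
Proof. by move=> ef u v s _ _ /(sub_walk ef) w; exists s. Qed.

(** A minimum is attained among simple walks, which have at most [#|V|] steps and thus live in the
    finite type of bounded sequences; any other walk is at least as long as some simple one. *)
Lemma shortest_walk e l x y s0 : (forall a b, e a b -> 0 <= l a b) ->
  walk e x y s0 ->
  exists s, [/\ walk e x y s, uniq (x :: s) &
    forall t, walk e x y t -> path_length l x s <= path_length l x t].
Proof.
move=> l0 w0; have sizeP t : uniq (x :: t) -> (size t <= #|V|)%N.
  by move/card_uniqP=> /= c; rewrite ltnW // -[(size t).+1]c max_card.
have [t0 [wt0 ut0 _]] := walk_simple l0 w0.
pose P (t : #|V|.-bseq V) := walk e x y t && uniq (x :: t).
pose F (t : #|V|.-bseq V) := path_length l x t.
have P0 : P (Bseq (sizeP _ ut0)) by apply/andP.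
case: (@Order.TotalTheory.arg_minP _ R _ _ P F P0) => t /andP[wt ut] min.
exists t; split=> // t' /(walk_simple l0)[t1 [wt1 ut1 le1]].
apply: le_trans le1; apply: (min (Bseq (sizeP _ ut1))).
by apply/andP.
Qed.

End Walks.

Lemma dist_le (R : realType) (V : finType) (G H : sgraph V)
    (l l' : V -> V -> R) (S : {set V}) (u v : V) :
  edge_lengths H l' -> dominated S (adj G) l (adj H) l' ->
  u \in S -> v \in S -> (dist H l' u v <= dist G l u v)%E.
Proof.
move=> el GH uS vS; apply: le_ereal_inf_tmp => _ [s [ps us ls] <-].
have [|t wt le] := GH u v s uS vS; first by apply/andP; rewrite ls.
have [|t' [/andP[pt lt] ut le']] := walk_simple (l := l') _ wt.
  by move=> a b /el[].
apply: ge_ereal_inf; exists (path_length l' u t')%:E.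
  by exists t' => //; split=> //; exact/eqP.
by rewrite lee_fin; exact: le_trans le.
Qed.

Lemma dist_eq (R : realType) (V : finType) (G H : sgraph V)
    (l l' : V -> V -> R) (S : {set V}) (u v : V) :
  edge_lengths G l -> edge_lengths H l' ->
  dominated S (adj G) l (adj H) l' -> dominated S (adj H) l' (adj G) l ->
  u \in S -> v \in S -> dist H l' u v = dist G l u v.
Proof.
by move=> eG eH GH HG uS vS; apply/eqP; rewrite eq_le (dist_le eH GH) ?(dist_le eG HG).
Qed.

(** * Subgraphs with few branching vertices *)

Lemma eq_set2 (T : finType) (x y a b : T) :
  [set x; y] = [set a; b] -> (x = a /\ y = b) \/ (x = b /\ y = a).
Proof.
move=> E.
have /set2P hx : x \in [set a; b] by rewrite -E set21.
have /set2P hy : y \in [set a; b] by rewrite -E set22.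
have /set2P ha : a \in [set x; y] by rewrite E set21.
have /set2P hb : b \in [set x; y] by rewrite E set22.
by case: hx hy ha hb => -> [] -> [] ? [] ?; subst; auto.
Qed.

Section PathEdges.
Variables (R : realType) (V : finType).
Implicit Types (e : rel V) (l : V -> V -> R) (x y u v : V) (s : seq V).

Definition path_edge u s : rel V :=
  fun x y => ((x, y) \in zip (u :: s) s) || ((y, x) \in zip (u :: s) s).

Lemma path_edge_sym u s : symmetric (path_edge u s).
Proof. by move=> x y; rewrite /path_edge orbC. Qed.

Lemma mem_zip_path u s x y : (x, y) \in zip (u :: s) s ->
  exists2 i, (i < size s)%N & x = nth u (u :: s) i /\ y = nth u s i.
Proof.
have sz : size (zip (u :: s) s) = size s.
  by rewrite size_zip /=; apply/minn_idPr.
case/(nthP (u, u)) => i; rewrite sz => lti E; exists i => //; move: E.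
by rewrite nth_zip_cond sz lti => -[-> ->].
Qed.

Lemma path_path_edge u s : path (path_edge u s) u s.
Proof.
apply/(pathP u) => i lti; apply/orP; left.
have sz : size (zip (u :: s) s) = size s.
  by rewrite size_zip /=; apply/minn_idPr.
have <- : nth (u, u) (zip (u :: s) s) i = (nth u (u :: s) i, nth u s i).
  by rewrite nth_zip_cond sz lti.
by rewrite mem_nth // sz.
Qed.

Lemma sub_path_edge e u s : symmetric e -> path e u s -> subrel (path_edge u s) e.
Proof.
move=> se /(pathP u) p x y.
by case/orP=> /mem_zip_path[i /p + [-> ->]] //; rewrite se.
Qed.

(** A simple path visits [x] at most once, so the only candidates are the entries just after and
    just before it. *)
Lemma path_edge_deg u s x : uniq (u :: s) ->
  (#|[set y | path_edge u s x y]| <= 2)%N.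
Proof.
move=> us; set p := u :: s; set i := index x p.
apply: (@leq_trans #|[set nth u p i.+1; nth u p i.-1]|); last first.
  by rewrite cards2; case: eqP.
apply/subset_leq_card/fintype.subsetP => y; rewrite !inE.
case/orP=> /mem_zip_path[j ltj [E1 E2]].
  by rewrite /i E1 E2 index_uniq ?eqxx //= ltnW.
have -> : i = j.+1; last by rewrite E1 eqxx orbT.
by rewrite /i E2 -[nth u s j]/(nth u p j.+1) index_uniq.
Qed.

(** Exchange argument: a shorter walk from [x] to [y] could replace the segment between them and
    shorten the whole walk. *)
Lemma shortest_subwalk e l u v s x y : symmetric e ->
  (forall a b, l a b = l b a) ->
  walk e u v s -> x \in u :: s -> y \in u :: s ->
  (forall t, walk e u v t -> path_length l u s <= path_length l u t) ->
  exists2 t, walk (path_edge u s) x y t &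
    forall t', walk e x y t' -> path_length l x t <= path_length l x t'.
Proof.
move=> se sl /andP[ps ls] + + min; have := path_path_edge u s.
move: (path_edge u s) (@path_edge_sym u s) (sub_path_edge se ps) => g sg ge pg.
(* If [y] comes before [x] on the walk, the segment from [y] to [x] is reversed. *)
wlog: x y / exists a b c, [/\ s = a ++ b ++ c, last u a = x & last x b = y].
  move=> W xs ys; case: (splitPl xs) (W) pg ys => a b lx {}W pg ys.
  have: y \in (u :: a) ++ b by [].
  rewrite mem_cat => /orP[] yb.
    case: (splitPl yb) lx W => a1 a2 ly lx W.
    have lx' := lx; rewrite last_cat ly in lx'.
    have [|||t wt mt] := W y x; first by exists a1, a2, b; rewrite catA.
    - by rewrite -ly -!cat_cons !mem_cat mem_last.
    - by rewrite -lx -cat_cons mem_cat mem_last.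
    have [t' wt' lt'] := walk_rev sg sl wt; exists t' => // t1 w1.
    by have [t2 w2 l2] := walk_rev se sl w1; rewrite lt' -l2 mt.
  have yb' : y \in x :: b by rewrite inE yb orbT.
  case: (splitPl yb') W ys => b1 b2 ly W ys.
  apply: W => //; first by exists a, b1, b2.
  by rewrite -lx -cat_cons mem_cat mem_last.
case=> a [b [c [Es lx ly]]] _ _; exists b.
  by move: pg; rewrite Es /walk !cat_path lx ly eqxx => /and3P[_ ->].
move=> t /andP[pt lt]; have := min (a ++ t ++ c).
rewrite {1}Es !path_length_cat lx ly (eqP lt) lerD2l lerD2r; apply.
move: ps ls; rewrite Es /walk !cat_path !last_cat lx ly (eqP lt) pt.
by case/and3P=> -> _ -> ->.
Qed.

End PathEdges.

Section SparseSubgraph.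
Variables (R : realType) (V : finType) (l : V -> V -> R).
Hypotheses (l_sym : forall a b, l a b = l b a) (l_ge0 : forall a b, 0 <= l a b).
Implicit Types (e : rel V) (x y u v : V) (s t : seq V) (S X : {set V}).

Definition remove_edge e a b : rel V :=
  fun x y => e x y && ([set x; y] != [set a; b]).

Lemma remove_edge_sym e a b : symmetric e -> symmetric (remove_edge e a b).
Proof. by move=> se x y; rewrite /remove_edge se finset.setUC. Qed.

(** Applied with [s] a shortest walk, where it says that removing the edge [ab] increases the
    distance from [u] to [v]. *)
Definition essential e a b u v s :=
  forall t, walk (remove_edge e a b) u v t ->
    path_length l u s < path_length l u t.

Lemma essential_mem e a b u v s : symmetric e -> walk e u v s ->
  essential e a b u v s -> path_edge u s a b.
Proof.
move=> se /andP[ps ls] ess; apply/negPn/negP => nab.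
suff /ess : walk (remove_edge e a b) u v s by rewrite ltxx.
rewrite /walk ls andbT; apply: sub_path (path_path_edge u s) => x y xy.
rewrite /remove_edge (sub_path_edge se ps) //=; apply: contraNN nab.
by move/eqP/eq_set2 => [[<- <-]|[<- <-]] //; rewrite path_edge_sym.
Qed.

(* If three vertices qualified, the segment of the first path between the two
   outer ones could be replaced by the segment of the second path, which avoids
   the edge that is essential at the middle one. *)
Lemma essential_branch_card e u1 v1 s1 u2 v2 s2 X : symmetric e ->
  walk e u1 v1 s1 -> uniq (u1 :: s1) -> walk e u2 v2 s2 ->
  (forall t, walk e u2 v2 t -> path_length l u2 s2 <= path_length l u2 t) ->
  (forall v, v \in X -> [/\ v \in u1 :: s1, v \in u2 :: s2 &
     exists2 x, ~~ path_edge u2 s2 v x & essential e v x u1 v1 s1]) ->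
  (#|X| <= 2)%N.
Proof.
move=> se w1 us1 w2 min2 HX; rewrite leqNgt; apply/negP => X3.
have [x0 x0X] : exists x, x \in X by apply/card_gt0P; rewrite (ltn_trans _ X3).
pose i v := index v (u1 :: s1).
case: (arg_minnP i x0X) => a aX mina; case: (arg_maxnP i x0X) => b bX maxb.
(* With [a] first and [b] last in [X] along the first path, a third element [c] lies strictly
   between them. *)
have [c /andP[cX cab]] : exists c, (c \in X) && (c \notin [set a; b]).
  have /card_gt0P[c] : (0 < #|X :\: [set a; b]|)%N.
    rewrite cardsD subn_gt0; apply: leq_ltn_trans X3.
    rewrite (leq_trans (subset_leq_card (finset.subsetIr _ _))) //.
    by rewrite cards2; case: eqP.
  by rewrite inE andbC; exists c.
have [a1 a2 _] := HX a aX; have [b1 b2 _] := HX b bX.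
have [c1 _ [x nx ess]] := HX c cX.
have inj : {in u1 :: s1 &, injective i} := @index_inj _ u1 (u1 :: s1).
have ac : (i a < i c)%N.
  rewrite ltn_neqAle mina // andbT; apply/eqP => /(inj _ _ a1 c1) ac.
  by rewrite ac set21 in cab.
have cb : (i c < i b)%N.
  rewrite ltn_neqAle [(i c <= i b)%N]maxb // andbT; apply/eqP => /(inj _ _ c1 b1) bc.
  by rewrite bc set22 in cab.
(* [t] is the segment of the second path between [a] and [b], hence a shortest walk between them. *)
have [t wt mt] := shortest_subwalk se l_sym w2 a2 b2 min2.
case: (splitPl a1) (us1) (b1) (c1) @i ac cb ess (w1) {inj mina maxb HX}.
move=> r1 r lr1 ur br cr i ac cb ess {}w1.
have notin v : (i a < i v)%N -> v \notin u1 :: r1.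
  have <- : size r1 = i a.
    rewrite /i -cat_cons index_cat -lr1 mem_last.
    rewrite lastI -cats1 index_cat /= eqxx addn0 size_belast.
    move: ur; rewrite -cat_cons lastI cat_uniq rcons_uniq.
    by case/and3P=> /andP[/negPf-> _] _ _.
  move=> lt; apply/negP => vr; move: lt.
  rewrite /i -cat_cons index_cat vr ltnNge -ltnS.
  by rewrite -[(size r1).+1]/(size (u1 :: r1)) index_mem vr.
have cr1 := notin c ac.
have br1 : b \in a :: r.
  have /negPf nb := notin b (ltn_trans ac cb).
  by move: br; rewrite -cat_cons mem_cat nb /= inE => ->; rewrite orbT.
case: (splitPl br1) (ur) (br) (cr) @i ac cb ess (w1) {notin}.
move=> r2 r3 lr2 {}ur {}br {}cr i ac cb ess {}w1.
have cbn : c != b by apply: contraTneq cb => ->; rewrite ltnn.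
have cr3 : c \notin r3.
  apply/negP => cr3; move: cb; rewrite ltnNge => /negP[].
  have E : u1 :: r1 ++ r2 ++ r3 = (u1 :: r1 ++ r2) ++ r3 by rewrite /= catA.
  have bi : b \in u1 :: r1 ++ r2 by rewrite -lr2 -lr1 -last_cat mem_last.
  rewrite /i E !index_cat bi.
  have /negPf-> : c \notin u1 :: r1 ++ r2.
    by move: ur; rewrite E cat_uniq => /and3P[_ /hasPn/(_ _ cr3)].
  by rewrite ltnW // ltn_addr // index_mem.
(* A walk that never visits [c] cannot use the edge [cx]. *)
have ra (q : V) p : c \notin q :: p -> path e q p -> path (remove_edge e c x) q p.
  elim: p q => [//|q' p IH] q; rewrite inE negb_or => /andP[cq cp] /= /andP[eq pp].
  rewrite IH // /remove_edge eq !andbT /=; apply/eqP => /eq_set2[] [E1 E2].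
    by rewrite E1 eqxx in cq.
  by rewrite E2 inE eqxx in cp.
have wtr : walk (remove_edge e c x) a b t.
  apply: sub_walk wt => p q pq; rewrite /remove_edge.
  have -> /= : e p q by case/andP: w2 => /(sub_path_edge se) + _; apply.
  by apply: contraNneq nx => /esym/eq_set2[] [-> ->] //; rewrite path_edge_sym.
case/andP: w1; rewrite !cat_path !last_cat lr1 lr2 => /and3P[p1 p2 p3] l3.
have /ess : walk (remove_edge e c x) u1 v1 (r1 ++ t ++ r3).
  case/andP: wtr => pt /eqP lt.
  rewrite /walk !cat_path !last_cat lr1 lt pt l3 andbT ra //= ra //.
  by rewrite inE negb_or cbn.
case/andP: (wt) => _ /eqP lt.
rewrite !path_length_cat lr1 lr2 lt ltrD2l ltrD2r ltNge => /negP[].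
by apply: mt; rewrite /walk p2 lr2 eqxx.
Qed.

(** Fix a shortest path for each connected pair. Each branching vertex then falls under the
    preceding lemma for some two pairs of terminals, and there are [#|S| ^ 4] choices of two
    pairs. *)
Lemma irredundant_branch_card e S : symmetric e ->
  (forall a b, e a b -> ~ dominated S e l (remove_edge e a b) l) ->
  (#|[set v | 2 < #|[set y | e v y]|]| <= 2 * #|S| ^ 4)%N.
Proof.
move=> se irr.
have /choice[P HP] (q : V * V) : exists s, (exists s', walk e q.1 q.2 s') ->
    [/\ walk e q.1 q.2 s, uniq (q.1 :: s) &
    forall t, walk e q.1 q.2 t -> path_length l q.1 s <= path_length l q.1 t].
  have [[s w]|n] := pselect (exists s, walk e q.1 q.2 s); last by exists [::].
  have l0 (a b : V) : e a b -> 0 <= l a b by [].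
  by have [s' Hs'] := shortest_walk l0 w; exists s'.
pose lab a b (q : V * V) := [/\ q.1 \in S, q.2 \in S,
  exists s, walk e q.1 q.2 s & essential e a b q.1 q.2 (P q)].
(* A terminal walk that cannot be matched without [ab] yields the pair: the fixed path is no longer
   than that walk. *)
have labP a b : e a b -> exists q, lab a b q.
  move=> /irr /existsNP[u /existsNP[v /existsNP[s]]].
  move=> /not_implyP[uS /not_implyP[vS /not_implyP[ws no]]]; exists (u, v).
  split=> //=; first by exists s.
  move=> t wt; rewrite ltNge; apply/negP => lt; apply: no; exists t => //.
  have [|_ _ min] := HP (u, v); first by exists s.
  exact: le_trans lt (min _ ws).
pose joined (q : V * V) := exists s, walk e q.1 q.2 s.
pose branch (q : (V * V) * (V * V)) v := [/\ joined q.1, joined q.2 &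
  exists2 x, ~~ path_edge q.2.1 (P q.2) v x & essential e v x q.1.1 q.1.2 (P q.1)].
pose W q := [set v | [&& v \in q.1.1 :: P q.1, v \in q.2.1 :: P q.2 &
  asbool (branch q v)]].
pose Q := finset.setX (finset.setX S S) (finset.setX S S).
have cW q : (#|W q| <= 2)%N.
  have [[v]|n] := pselect (exists v, v \in W q); last first.
    by rewrite leqNgt; apply/negP => /ltnW/ltnW/card_gt0P.
  rewrite inE => /and3P[_ _ /asboolP[c1 c2 _]].
  have [w1 u1 m1] := HP _ c1; have [w2 u2 m2] := HP _ c2.
  apply: (essential_branch_card se w1 u1 w2 m2) => {}v.
  by rewrite inE => /and3P[? ? /asboolP[_ _ ?]].
have sub : [set v | 2 < #|[set y | e v y]|]%N \subset \bigcup_(q in Q) W q.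
  apply/fintype.subsetP => v; rewrite inE => dv.
  have mem_ess a b q : lab a b q -> path_edge q.1 (P q) a b.
    case=> _ _ /HP[w _ _]; exact: (essential_mem se w).
  have /card_gt0P[y] := leq_ltn_trans (leq0n 2) dv.
  rewrite inE => /labP[q2 lab2].
  have [_ _ c2 _] := lab2; have [_ u2 _] := HP _ c2.
  (* The path of [q2] uses at most two of the three or more edges at [v], so it misses some edge
     [vx], which is essential for another pair [q1]. *)
  have [x evx nx] : exists2 x, e v x & ~~ path_edge q2.1 (P q2) v x.
    have /subsetPn[x] : ~~ ([set y | e v y] \subset
        [set y | path_edge q2.1 (P q2) v y]).
      apply/negP => /subset_leq_card le.
      by have := leq_trans dv (leq_trans le (path_edge_deg _ u2)).
    by rewrite !inE => ? ?; exists x.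
  have [q1 lab1] := labP _ _ evx.
  have [uS1 vS1 c1 ess1] := lab1; have [uS2 vS2 _ _] := lab2.
  have mv q z : path_edge q.1 (P q) v z -> v \in q.1 :: P q.
    case/orP=> /mem_zip_path[i lti [E1 E2]]; first by rewrite E1 mem_nth //= ltnW.
    by rewrite E2 inE mem_nth ?orbT.
  apply/bigcupP; exists (q1, q2); first by rewrite !inE uS1 vS1 uS2.
  rewrite inE (mv _ _ (mem_ess _ _ _ lab1)) (mv _ _ (mem_ess _ _ _ lab2)) /=.
  by apply/asboolP; split=> //; exists x.
apply: leq_trans (subset_leq_card sub) _.
apply: (@leq_trans (\sum_(q in Q) 2)).
  elim/big_rec2: _ => [|q n A _ IH]; first by rewrite cards0.
  by rewrite (leq_trans (leq_card_setU _ _).1) // leq_add.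
by rewrite sum_nat_const !cardsX mulnC; lia.
Qed.

(** Edges whose removal preserves domination are removed until none is left; the number of edges
    drops each time. *)
Lemma sparse_subgraph e S : symmetric e ->
  exists f : rel V, [/\ symmetric f, subrel f e, dominated S e l f l &
    (#|[set v | 2 < #|[set y | f v y]|]| <= 2 * #|S| ^ 4)%N].
Proof.
have [n] := ubnP #|[set q | e q.1 q.2]|; elim: n e => // n IH e ltn se.
have [[a [b [eab dom]]]|irr] := pselect (exists a b,
    e a b /\ dominated S e l (remove_edge e a b) l).
  have [||f [sf fe df cf]] := IH (remove_edge e a b).
  - rewrite -ltnS; apply: leq_trans ltn; rewrite ltnS; apply: proper_card.
    apply/properP; split; first by apply/fintype.subsetP => q; rewrite !inE => /andP[].
    by exists (a, b); rewrite !inE //= /remove_edge eqxx andbF.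
  - exact: remove_edge_sym.
  exists f; split=> //; first by move=> x y /fe/andP[].
  exact: dominated_trans df.
exists e; split=> //; first exact: sub_dominated.
by apply: irredundant_branch_card => // a b eab d; apply: irr; exists a, b.
Qed.
End SparseSubgraph.

(** * Separations from tree decompositions *)

Section Separation.
Variables (V I : finType) (D : {set I}) (r : rel I) (B : I -> {set V}).
Variable w : nat.
Hypotheses (r_sym : symmetric r) (r_acyclic : acyclic r).
Hypothesis bag_le : forall i, i \in D -> (#|B i| <= w)%N.
Hypothesis bag_conn : forall x, connected_on r [set i in D | x \in B i].
Implicit Types (S : {set V}) (X Y : {set I}) (t i j : I).

Definition bags X := \bigcup_(i in X) B i.

(* X is a union of connected components of the tree minus t. *)
Definition branch t X := [/\ t \in D, X \subset D, t \notin X &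
  forall i j, i \in X -> j \in D -> r i j -> (j == t) || (j \in X)].

(** The nodes whose bags contain a common vertex form a connected set, and a path leaving [X] in it
    must step to [t] first. *)
Lemma branch_sep t X : branch t X -> bags X :&: bags (D :\: X) \subset B t.
Proof.
case=> tD /fintype.subsetP XD tX cl; apply/fintype.subsetP => x.
rewrite inE => /andP[/bigcupP[i iX xi] /bigcupP[j]].
rewrite inE => /andP[jX jD] xj.
have iE : i \in [set i in D | x \in B i] by rewrite inE XD.
have jE : j \in [set i in D | x \in B i] by rewrite inE jD.
have /connectP[p pp lp] := bag_conn iE jE.
elim: p i iX pp lp {iE xi} => [|k p IH] i iX /=.
  by move=> _ ji; rewrite ji iX in jX.
case/andP=> /and3P[_ kE rik] pp lp; move: kE; rewrite inE => /andP[kD xk].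
by have /orP[/eqP<-//|kX] := cl _ _ iX kD rik; apply: IH kX pp lp.
Qed.

(** If [X] is disconnected, one of two parts keeps at least half of the terminals, with the same
    [t]. If it is connected, [t] moves to its neighbour [a] in [X], which costs at most the [w]
    vertices of the bag of [a]. *)
Lemma branch_split t X S : branch t X -> (6 * w < #|(S :&: bags X) :\: B t|)%N ->
  exists t' Y, [/\ branch t' Y, (#|Y| < #|X|)%N &
    (3 * w <= #|(S :&: bags Y) :\: B t'|)%N].
Proof.
move=> [tD XD tX cl] big.
(* [a] is a neighbour of [t] in [X] if there is one, and arbitrary otherwise. *)
have [a aX ta] : exists2 a, a \in X & forall i, i \in X -> r i t -> r a t.
  have [[a [aX rat]]|no] := pselect (exists a, a \in X /\ r a t).
    by exists a.
  have /card_gt0P[x] := leq_ltn_trans (leq0n _) big.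
  rewrite !inE => /and3P[_ _ /bigcupP[a aX _]]; exists a => // i iX rit.
  by case: no; exists i.
pose rX := [rel i j | [&& i \in X, j \in X & r i j]].
pose Y := [set j in X | connect rX a j].
have XDP := fintype.subsetP XD.
have YX : Y \subset X by apply/fintype.subsetP => i; rewrite inE => /andP[].
have bY : branch t Y.
  split=> //; first exact: fintype.subset_trans XD.
    by rewrite inE (negPf tX).
  move=> i j; rewrite inE => /andP[iX ci] jD rij.
  have /orP[->//|jX] := cl _ _ iX jD rij.
  by rewrite inE jX (connect_trans ci) ?orbT // connect1 //= iX jX.
have bXY : branch t (X :\: Y).
  split=> //; first exact: fintype.subset_trans (finset.subsetDl _ _) XD.
    by rewrite inE (negPf tX) andbF.
  move=> i j; rewrite inE => /andP[iY iX] jD rij.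
  have /orP[->//|jX] := cl _ _ iX jD rij.
  rewrite inE jX andbT; apply/orP; right; apply: contra iY.
  rewrite inE => /andP[_ cj]; rewrite inE iX (connect_trans cj) //.
  by rewrite connect1 //= iX jX r_sym.
have aY : a \in Y by rewrite inE aX connect0.
have [XY|XY] := eqVneq Y X; last first.
  have ltY : (#|Y| < #|X|)%N by rewrite proper_card // finset.properEneq XY.
  have ltXY : (#|X :\: Y| < #|X|)%N.
    apply: proper_card; apply/properP; split; first exact: finset.subsetDl.
    by exists a => //; rewrite inE aY.
  have le : (#|(S :&: bags X) :\: B t| <= #|(S :&: bags Y) :\: B t| +
      #|(S :&: bags (X :\: Y)) :\: B t|)%N.
    apply: leq_trans (leq_card_setU _ _).1; apply/subset_leq_card.
    apply/fintype.subsetP => x; rewrite !inE => /and3P[-> -> /bigcupP[i iX xi]] /=.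
    have [iY|iY] := boolP (i \in Y).
      by apply/orP; left; apply/bigcupP; exists i.
    by apply/orP; right; apply/bigcupP; exists i => //; rewrite inE iY.
  have [g|g] := leqP (3 * w) #|(S :&: bags Y) :\: B t|; first by exists t, Y.
  by exists t, (X :\: Y); split=> //; lia.
exists a, (X :\ a); split.
- split; rewrite ?XDP //.
  + exact: fintype.subset_trans (finset.subsetDl _ _) XD.
  + by rewrite !inE eqxx.
  move=> i j; rewrite !inE => /andP[ia iX] jD rij.
  have /orP[/eqP jt|->] := cl _ _ iX jD rij; last by rewrite andbT orbN.
  rewrite jt in rij; have rat := ta _ iX rij.
  have : i \in Y by rewrite XY.
  rewrite inE => /andP[_ /connectP[p0 pp0 ip]].
  move: ia rij; rewrite ip; case: (shortenP pp0) => p pp up _ ia rij; exfalso.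
  have pX : all [in X] p.
    by elim: (p) (a) pp => //= k q IH b /andP[/and3P[_ -> _] /IH].
  (* A second neighbour [i] of [t] in [X] would close a cycle with [a], through the path from [a] to
     [i] inside [X]. *)
  apply: (r_acyclic (s := t :: a :: p)); first by case: (p) ia; rewrite ?eqxx.
  apply/andP; split.
    rewrite /= rcons_path r_sym rat rij andbT /=.
    by apply: sub_path pp => b c /and3P[].
  rewrite cons_uniq up andbT inE negb_or; apply/andP; split.
    by apply: contraNneq tX => ->.
  by apply: contra tX => /(allP pX).
- by rewrite [#|X|](cardsD1 a) aX.
have : (#|(S :&: bags X) :\: B t| <= #|(S :&: bags (X :\ a)) :\: B a| + #|B a|)%N.
  apply: leq_trans (leq_card_setU _ _).1; apply/subset_leq_card.
  apply/fintype.subsetP => x; rewrite !inE => /and3P[_ -> /bigcupP[i iX xi]] /=.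
  have [//|xa /=] := boolP (x \in B a); rewrite ?orbT // orbF.
  apply/bigcupP; exists i => //; rewrite !inE iX andbT.
  by apply: contraNneq xa => <-.
by have := bag_le (XDP _ aX); lia.
Qed.

(** Any node [t] with all other nodes as branch keeps at least [4w - w] terminals outside its bag.
    Splitting shrinks the branch and keeps [3w] terminals, so it ends with at most [6w]; then [A] is
    the union of the bags in the branch and [C] that of the others. *)
Lemma separation S : (0 < w)%N -> S \subset bags D -> (4 * w <= #|S|)%N ->
  exists A C : {set V}, [/\ forall i, i \in D -> B i \subset A \/ B i \subset C,
    A \subset bags D, (#|A :&: C| <= w)%N, (3 * w <= #|S :&: (A :\: C)|)%N &
    (#|S :&: (A :\: C)| <= 6 * w)%N].
Proof.
move=> w0 /fintype.subsetP SD S4.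
have [t tD] : exists t, t \in D.
  have /card_gt0P[x /SD/bigcupP[t tD _]] : (0 < #|S|)%N by lia.
  by exists t.
have : branch t (D :\ t).
  split; rewrite ?finset.subsetDl ?inE ?eqxx // => i j _ jD _.
  by rewrite !inE jD andbT orbN.
have : (3 * w <= #|(S :&: bags (D :\ t)) :\: B t|)%N.
  have : (#|S| <= #|(S :&: bags (D :\ t)) :\: B t| + #|B t|)%N.
    apply: leq_trans (leq_card_setU _ _).1; apply/subset_leq_card.
    apply/fintype.subsetP => x xS; rewrite !inE xS.
    have [//|xt /=] := boolP (x \in B t); rewrite ?orbT // orbF.
    have /bigcupP[i iD xi] := SD _ xS; apply/bigcupP; exists i => //.
    by rewrite !inE iD andbT; apply: contraNneq xt => <-.
  by have := bag_le tD; lia.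
have [n] := ubnP #|D :\ t|; move: {tD} t (D :\ t).
elim: n => // n IH t X leX ge bX.
have [big|small] := ltnP (6 * w) #|(S :&: bags X) :\: B t|.
  have [t' [Y [bY lt geY]]] := branch_split bX big.
  by apply: IH geY bY; apply: leq_trans lt _.
have [tD XD tX _] := bX; have sep := branch_sep bX.
(* As [t] itself is outside [X], the part of [bags X] shared with the other side is exactly its part
   in [B t]. *)
have E : S :&: (bags X :\: bags (D :\: X)) = (S :&: bags X) :\: B t.
  apply/finset.setP => x; rewrite !inE.
  case: (x \in S); rewrite ?andbF //=; case xX: (x \in bags X); rewrite ?andbF // !andbT.
  congr (~~ _); apply/idP/idP => [xDX|xt].
    by apply: (fintype.subsetP sep); rewrite inE xX.
  by apply/bigcupP; exists t => //; rewrite inE tX.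
exists (bags X), (bags (D :\: X)); rewrite E; split=> //.
  move=> i iD; have [iX|iX] := boolP (i \in X); [left|right].
    exact: finset.bigcup_sup.
  by apply: finset.bigcup_sup; rewrite inE iX.
  apply/finset.bigcupsP => i iX; exact: finset.bigcup_sup (fintype.subsetP XD _ iX).
exact: leq_trans (subset_leq_card sep) (bag_le tD).
Qed.

End Separation.

(** * Gluing along a separation *)

Section Gluing.
Variables (R : realType) (V : finType) (l : V -> V -> R).
Implicit Types (e f : rel V) (S A C P : {set V}).

Definition induced e A : rel V := fun x y => [&& e x y, x \in A & y \in A].

Lemma induced_sym e A : symmetric e -> symmetric (induced e A).
Proof. by move=> se x y; rewrite /induced se andbA andbAC -andbA. Qed.

(** The visits to [P] cut a walk between terminals into pieces, each on one side and with ends in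
    [P], which can be replaced separately. *)
Lemma dominated_glue e fA fC A C P :
  (forall x y, e x y -> induced e A x y || induced e C x y) ->
  A :&: C \subset P ->
  dominated (P :&: A) (induced e A) l fA l ->
  dominated (P :&: C) (induced e C) l fC l ->
  dominated P e l (relU fA fC) l.
Proof.
move=> cov /fintype.subsetP ACP domA domC.
pose f : rel V := relU fA fC.
(* Replaces one piece. The empty piece is treated apart, since its only vertex may lie outside
   [Q]. *)
have fin Q u v s : Q = A \/ Q = C -> u \in P -> v \in P -> walk (induced e Q) u v s ->
    exists2 t, walk f u v t & path_length l u t <= path_length l u s.
  move=> HQ uP vP ws.
  case: s ws => [/andP[_ /= /eqP<-]|y s ws].
    by exists [::] => //; rewrite /walk /= eqxx.
  have [uQ vQ] : u \in Q /\ v \in Q.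
    move: ws => /andP[/= /andP[/and3P[_ -> yQ] ps] /eqP<-]; split=> //.
    elim: s y yQ ps => [//|z s IH] y yQ /= /andP[/and3P[_ _ zQ]]; exact: IH.
  case: HQ => E; rewrite {}E in uQ vQ ws.
    have [||t wt lt] := domA _ _ _ _ _ ws; rewrite ?inE ?uP ?vP //.
    by exists t => //; apply: sub_walk wt => a b ab; rewrite /f /= ab.
  have [||t wt lt] := domC _ _ _ _ _ ws; rewrite ?inE ?uP ?vP //.
  by exists t => //; apply: sub_walk wt => a b ab; rewrite /f /= ab orbT.
(* [q] is the part of the walk since its last visit to [P]; it stays on one
   side, since its interior vertices avoid [P] and hence [A :&: C]. *)
suff gen s Q u x v q : Q = A \/ Q = C -> u \in P -> v \in P ->
    (x \in P) || (q != [::]) -> walk (induced e Q) u x q -> walk e x v s ->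
    exists2 t, walk f u v t & path_length l u t <= path_length l u q + path_length l x s.
  move=> u v s uP vP ws.
  have [||t wt lt] := gen s A u u v [::] (or_introl erefl) uP vP _ _ ws.
  - by rewrite uP.
  - by rewrite /walk /= eqxx.
  by exists t => //; rewrite add0r in lt.
elim: s Q u x v q => [|y s IH] Q u x v q HQ uP vP xq wq ws.
  move: ws => /andP[_ /= /eqP xv]; rewrite xv in wq.
  by rewrite addr0; apply: fin wq.
move: ws => /andP[/= /andP[exy ps] ls].
have ws : walk e y v s by apply/andP.
have [xP|xP] := boolP (x \in P).
  have [t1 wt1 lt1] := fin _ _ _ _ HQ uP xP wq.
  have [Q' [HQ' exy']] : exists Q', (Q' = A \/ Q' = C) /\ induced e Q' x y.
    by case/orP: (cov _ _ exy) => ?; [exists A | exists C]; split=> //; [left|right].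
  have [||t2 wt2 lt2] := IH Q' x y v [:: y] HQ' xP vP _ _ ws.
  - by rewrite orbT.
  - by rewrite /walk /= exy' eqxx.
  exists (t1 ++ t2); first exact: walk_cat wt1 wt2.
  rewrite path_length_cat; case/andP: wt1 => _ /eqP ->.
  by move: lt1 lt2; rewrite /= addr0; lra.
have xQ : x \in Q.
  move: xq wq; rewrite (negPf xP) /=; case/lastP: q => // q z _ /andP[].
  by rewrite rcons_path last_rcons => /andP[_ /and3P[_ _ zQ]] /eqP<-.
have exy' : induced e Q x y.
  case/orP: (cov _ _ exy) HQ => exy' [E|E]; rewrite E in xQ *; rewrite ?E //.
    by case/and3P: exy' => _ xA _; case/negP: xP; apply: ACP; rewrite inE xA.
  by case/and3P: exy' => _ xC _; case/negP: xP; apply: ACP; rewrite inE xQ.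
have [||t wt lt] := IH Q u y v (rcons q y) HQ uP vP _ _ ws.
- by rewrite -size_eq0 size_rcons orbT.
- rewrite -cats1; apply: (walk_cat wq); by rewrite /walk /= exy' eqxx.
exists t => //; apply: le_trans lt _.
rewrite -cats1 path_length_cat /= addr0; case/andP: wq => _ /eqP->.
by rewrite addrA.
Qed.

End Gluing.

(** * Recursion over separations *)

Section Recursion.
Variables (R : realType) (V : finType) (l : V -> V -> R).
Hypotheses (l_sym : forall a b, l a b = l b a) (l_ge0 : forall a b, 0 <= l a b).
Variables (I : finType) (D : {set I}) (r : rel I) (B : I -> {set V}) (w : nat).
Hypotheses (w_gt0 : (0 < w)%N) (r_sym : symmetric r) (r_acyclic : acyclic r).
Hypothesis bag_le : forall i, i \in D -> (#|B i| <= w)%N.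
Hypothesis bag_conn : forall x, connected_on r [set i in D | x \in B i].

(** The constant satisfies [2 * 2402 >= 2 * 7 ^ 4 + 1]: each separation costs at most
    [2 * (7 * w) ^ 4] branching vertices in [A] and [w] in the separator, paid for by the [2 * w]
    terminals that the recursive call saves. *)
Lemma sparse_subgraph_treewidth (S : {set V}) (e : rel V) :
  symmetric e -> S \subset bags B D ->
  (forall x y, e x y -> exists2 i, i \in D & (x \in B i) && (y \in B i)) ->
  exists f : rel V, [/\ symmetric f, subrel f e, dominated S e l f l &
    (#|[set v | v \notin S & 2 < #|[set y | f v y]|]| <= 2402 * w ^ 3 * #|S|)%N].
Proof.
have [n] := ubnP #|S|; elim: n S e => // n IH S e ltn se SB eB.
have [small|big] := ltnP #|S| (4 * w)%N.
  have [f [sf fe df cf]] := sparse_subgraph l_sym l_ge0 S se; exists f; split=> //.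
  have le : (#|S| ^ 3 <= (4 * w) ^ 3)%N by rewrite leq_exp2r // ltnW.
  apply: (@leq_trans (2 * #|S| ^ 4)).
    apply: leq_trans cf; apply/subset_leq_card/fintype.subsetP => v.
    by rewrite !inE => /andP[].
  rewrite expnS mulnCA mulnC leq_mul2r; apply/orP; right.
  by rewrite expnMn in le; lia.
have [A [C [AC AD wAC ge le]]] := separation r_sym r_acyclic bag_le bag_conn w_gt0 SB big.
have cov x y : e x y -> induced e A x y || induced e C x y.
  move=> exy; have [i /AC[] /fintype.subsetP BA /andP[/BA xA /BA yA]] := eB _ _ exy.
    by rewrite /induced exy xA yA.
  by rewrite /induced exy xA yA orbT.
pose P := S :|: (A :&: C).
have cA : (#|P :&: A| <= 7 * w)%N.
  apply: (@leq_trans #|(S :&: (A :\: C)) :|: (A :&: C)|).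
    apply/subset_leq_card/fintype.subsetP => x; rewrite !inE.
    by case: (x \in S); case: (x \in A); case: (x \in C).
  by apply: leq_trans (leq_card_setU _ _).1 _; lia.
(* At least [3w] terminals stay behind in [A :\: C], and at most [w] separator vertices are
   added. *)
have cC : (#|P :&: C| + 2 * w <= #|S|)%N.
  have : (#|P :&: C| <= #|S :\: (A :\: C)| + #|A :&: C|)%N.
    apply: leq_trans (leq_card_setU _ _).1.
    apply/subset_leq_card/fintype.subsetP => x; rewrite !inE.
    by case: (x \in S); case: (x \in A); case: (x \in C).
  by have := cardsID (A :\: C) S; lia.
have [fA [sfA feA dA bA]] := sparse_subgraph l_sym l_ge0 (P :&: A) (induced_sym A se).
have [||||fC [sfC feC dC bC]] := IH (P :&: C) (induced e C).
- by lia.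
- exact: induced_sym.
- apply: fintype.subset_trans (finset.subsetIl _ _) _.
  rewrite finset.subUset SB.
  exact: fintype.subset_trans (finset.subsetIl _ _) AD.
- by move=> x y /and3P[/eB].
exists (relU fA fC); split.
- by move=> x y /=; rewrite sfA sfC.
- by move=> x y /= /orP[/feA|/feC] /and3P[].
- move=> u v s uS vS ws; apply: (dominated_glue cov _ dA dC) ws.
  + exact: finset.subsetUr.
  + by rewrite inE uS.
  + by rewrite inE vS.
(* Outside the separator all edges at a vertex come from one side, so its degree in the union is its
   degree there. *)
have : (#|[set v | v \notin S & 2 < #|[set y | relU fA fC v y]|]| <=
   #|A :&: C| + #|[set v | 2 < #|[set y | fA v y]|]| +
   #|[set v | v \notin P :&: C & 2 < #|[set y | fC v y]|]|)%N.
  apply: leq_trans (leq_add (leq_card_setU _ _).1 (leqnn _)).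
  apply: leq_trans (leq_card_setU _ _).1.
  apply/subset_leq_card/fintype.subsetP => v; rewrite !inE => /andP[vS dv].
  have [vA|vA] := boolP (v \in A); have [vC|vC] := boolP (v \in C) => //=.
  - apply/orP; left; apply: leq_trans dv _; apply/subset_leq_card/fintype.subsetP => y.
    by rewrite !inE /= => /orP[//|/feC/and3P[_]]; rewrite (negPf vC).
  - rewrite (negPf vS) /=; apply/orP; right.
    apply: leq_trans dv _; apply/subset_leq_card/fintype.subsetP => y.
    by rewrite !inE /= => /orP[/feA/and3P[_]|//]; rewrite (negPf vA).
  move: dv; rewrite (_ : [set y | _] = finset.set0) ?cards0 //.
  apply/finset.setP => y; rewrite !inE /=; apply/negP.
  by case/orP=> [/feA/and3P[_]|/feC/and3P[_]]; rewrite ?(negPf vA) ?(negPf vC).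
have b1 : (#|[set v | 2 < #|[set y | fA v y]|]| <= 4802 * w ^ 3 * w)%N.
  apply: leq_trans bA _.
  have : (#|P :&: A| ^ 4 <= (7 * w) ^ 4)%N by rewrite leq_exp2r.
  by rewrite expnMn expnSr; lia.
have b2 : (2402 * w ^ 3 * #|P :&: C| + 2402 * w ^ 3 * (2 * w) <= 2402 * w ^ 3 * #|S|)%N.
  by rewrite -mulnDr leq_mul2l cC orbT.
have b3 : (w <= w ^ 3 * w)%N by rewrite leq_pmull // expn_gt0 w_gt0.
move=> b0; apply: leq_trans b0 _.
move: bC b1 b2 b3; move: (w ^ 3)%N => q bC b1 b2 b3.
by rewrite [(2402 * q * (2 * w))%N](_ : _ = 4804 * q * w)%N in b2; nia.
Qed.
End Recursion.

(** * Minors *)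

(** Runs through all pairs and deletes the edges outside [f]; only edge deletions are used. *)
Lemma minor_subgraph (V : finType) (S : {set V}) (G : sgraph V) (f : rel V) :
  symmetric f -> subrel f (adj G) -> exists2 H, minor_wrt S G H & adj H =2 f.
Proof.
move=> sf fG.
have [H mH adjH] : exists2 H, minor_wrt S G H & forall a b, adj H a b =
    adj G a b && all (fun q => f q.1 q.2 || ([set a; b] != [set q.1; q.2]))
      (enum {: V * V}).
  elim: (enum _) => [|q qs [H mH adjH]].
    by exists G; [exact: minor_refl | move=> a b; rewrite andbT].
  have [fq|fq] := boolP (f q.1 q.2).
    by exists H => // a b; rewrite adjH /= fq.
  exists (del_edge H q.1 q.2); first exact: minor_del_edge.
  move=> a b; rewrite [LHS]/= /del_edge_adj adjH /= (negPf fq) /=.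
  by rewrite -andbA; congr (_ && _); rewrite andbC.
exists H => // a b; rewrite adjH; apply/andP/idP => [[_ /allP/(_ (a, b))]|fab].
  by rewrite mem_enum eqxx orbF; apply.
split; first exact: fG.
apply/allP => -[c d] _ /=; have [//|fcd] := boolP (f c d).
by apply: contraNneq fcd => /eq_set2[[<- <-]|[<- <-]] //; rewrite sf.
Qed.

Section Elimination.
Variables (R : realType) (V : finType).
Implicit Types (G H : sgraph V) (l : V -> V -> R) (S : {set V}) (u v x z : V).

(** Imposed on all pairs, not only on edges, so that it survives a change of the edge set. *)
Definition nonneg_sym l := forall a b, l a b = l b a /\ 0 <= l a b.

Lemma nonneg_sym_edge_lengths G l : nonneg_sym l -> edge_lengths G l.
Proof. by move=> nl a b _. Qed.

Definition degree G v := #|[set y | adj G v y]|.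

Lemma dominated_edges S (e f : rel V) l l' :
  (forall a b, e a b -> exists2 t, walk f a b t & path_length l' a t <= l a b) ->
  dominated S e l f l'.
Proof.
move=> H u v s _ _; elim: s u => [|y s IH] u.
  by move=> w; exists [::].
case/andP=> /= /andP[/H[t1 w1 l1] ps] ls.
have [|t2 w2 l2] := IH y; first exact/andP.
exists (t1 ++ t2); first exact: walk_cat w1 w2.
by rewrite path_length_cat; case/andP: w1 => _ /eqP->; rewrite lerD.
Qed.

(** * Suppressing a vertex of degree one or two *)

Section Suppress.
Variables (H : sgraph V) (l : V -> V -> R) (v x z : V).
Hypotheses (nl : nonneg_sym l) (vx : adj H v x) (vz : adj H v z).
Hypothesis nbr : forall y, adj H v y -> y = x \/ y = z.

(** The edge [xz] takes the shorter of its own length, if present, and the length through [v].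
    Degree one is the case [x = z], where only the value at the pair [(x, x)] changes, which is not
    an edge. *)
Definition suppress_length : V -> V -> R := fun a b =>
  if [set a; b] == [set x; z] then
    if adj H x z then Num.min (l x z) (l x v + l v z) else l x v + l v z
  else l a b.

Lemma suppress_length_nonneg_sym : nonneg_sym suppress_length.
Proof.
move=> a b; rewrite /suppress_length [[set b; a]]finset.setUC; split.
  by case: ifP => // _; case: (nl a b).
have [_ ab] := nl a b; have [_ xz] := nl x z; have [_ xv] := nl x v.
have [_ vz0] := nl v z.
case: ifP => // _; case: ifP => _; rewrite ?le_min ?xz /=; exact: addr_ge0.
Qed.

Lemma contract_edge a b : contract_adj H x v a b ->
  adj H a b \/ [set a; b] = [set x; z].
Proof.
case/and4P=> _ _ nab /or3P[|/andP[/eqP ax /nbr[] bE]|/andP[/eqP bx]]; first by left.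
- by rewrite ax bE eqxx in nab.
- by right; rewrite ax bE.
rewrite adj_sym => /nbr[] aE; first by rewrite bx aE eqxx in nab.
by right; rewrite bx aE finset.setUC.
Qed.

(** A passage through [v] goes between its neighbours: it becomes the edge [xz], or is dropped if it
    returns to the same neighbour. The ends of the walk are terminals, hence not [v]. *)
Lemma suppress_dominated S : v \notin S ->
  dominated S (adj H) l (contract_adj H x v) suppress_length.
Proof.
move=> vS a b s aS bS.
have av : a != v by apply: contraTneq aS => ->.
have bv : b != v by apply: contraTneq bS => ->.
(* Induction on a size bound, since a passage through [v] consumes two edges at once. *)
move: av; have [n] := ubnP (size s); elim: n s a {aS} => // n IH [|y s] a /=.
  by move=> _ _ w; exists [::].
rewrite ltnS => lts av /andP[/= /andP[ay ps] ls].
have ell_le c d : adj H c d -> suppress_length c d <= l c d.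
  move=> cd; rewrite /suppress_length; case: eqP => // /eq_set2[] [cE dE].
    by rewrite cE dE in cd *; rewrite cd ge_min lexx.
  rewrite cE dE adj_sym in cd *; have [-> _] := nl z x.
  by rewrite cd ge_min lexx.
have inV c d : adj H c d -> c != v -> c \in verts H :\ v.
  by move=> /adj_verts cH cv; rewrite !inE cv.
have [yv|yv] := eqVneq y v; last first.
  have [|t wt lt] := IH s y lts yv; first exact/andP.
  exists (y :: t); last by apply: lerD => //; exact: ell_le.
  case/andP: wt => pt lt'; rewrite /walk /= pt lt' !andbT /contract_adj ay.
  rewrite (inV _ _ ay) // (inV y a) 1?adj_sym //.
  by rewrite /= andbT; apply: contraTneq ay => ->; rewrite adj_irrefl.
rewrite {}yv in ay ps ls *; case: s lts ps ls => [|c s] lts /=.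
  by move=> _ vb; rewrite eq_sym (negPf bv) in vb.
case/andP=> vc ps ls.
have cv : c != v by apply: contraTneq vc => ->; rewrite adj_irrefl.
have [||t wt lt] := IH s c _ cv; [exact: ltnW | exact/andP |].
have [ac|ac] := eqVneq a c.
  exists t; rewrite ac //; apply: le_trans lt _.
  by have [_] := nl c v; have [_] := nl v c; lra.
have va : adj H v a by rewrite adj_sym.
have E : [set a; c] = [set x; z].
  case: (nbr va) (nbr vc) ac => -> [] ->; rewrite ?eqxx //.
  by rewrite finset.setUC.
exists (c :: t).
  case/andP: wt => pt lt'; rewrite /walk /= pt lt' !andbT /contract_adj.
  rewrite (inV _ _ ay) // (inV c v) 1?adj_sym // ac /=.
  move/eq_set2: E => [] [aE cE]; rewrite aE cE eqxx ?vz ?orbT //.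
  by rewrite [adj H z v]adj_sym vz !orbT.
rewrite /= addrA; apply: lerD => //; rewrite /suppress_length E eqxx.
have -> : l a v + l v c = l x v + l v z.
  have [s1 _] := nl z v; have [s2 _] := nl v x.
  by move/eq_set2: E => [] [-> ->] //; rewrite s1 s2 addrC.
by case: ifP => // _; rewrite ge_min lexx orbT.
Qed.

Lemma dominated_suppress S :
  dominated S (contract_adj H x v) suppress_length (adj H) l.
Proof.
apply: dominated_edges => a b cab; rewrite /suppress_length.
case: eqP => [/eq_set2 E|nE]; last first.
  have [ab|//] := contract_edge cab; exists [:: b]; last by rewrite /= addr0.
  by rewrite /walk /= ab eqxx.
have via : exists2 t, walk (adj H) a b t & path_length l a t <= l x v + l v z.
  have [s1 _] := nl z v; have [s2 _] := nl v x.
  exists [:: v; b]; case: E => [] [-> ->]; rewrite /walk /= ?addr0 ?eqxx ?andbT //.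
  - by rewrite adj_sym vx.
  - by rewrite adj_sym vz.
  by rewrite s1 s2 addrC.
case: ifP => // xz; case: leP => // _; exists [:: b].
  by case: E => [] [-> ->]; rewrite /walk /= 1?[adj H z x]adj_sym xz eqxx.
by have [s1 _] := nl z x; case: E => [] [-> ->]; rewrite /= addr0 // s1.
Qed.

(** A neighbour of [v] loses [v] and gains at most the other neighbour [o]; other vertices gain
    nothing. *)
Lemma degree_contract u : (degree (Defs.contract H x v) u <= degree H u)%N.
Proof.
have [uv|uv] := boolP (adj H u v); last first.
  apply/subset_leq_card/fintype.subsetP => b; rewrite !inE /= => /and4P[_ _ _].
  case/or3P=> // /andP[/eqP E]; last by rewrite (negPf uv).
  by rewrite E adj_sym vx in uv.
have vu : adj H v u by rewrite adj_sym.
pose o := if u == x then z else x.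
rewrite /degree [leqRHS](cardsD1 v) inE uv addnC.
apply: (@leq_trans #|([set y | adj H u y] :\ v) :|: [set o]|); last first.
  by apply: leq_trans (leq_card_setU _ _).1 _; rewrite cards1.
apply/subset_leq_card/fintype.subsetP => b; rewrite !inE /=.
case/and4P=> _; rewrite finset.in_setD1 => /andP[-> _] ub /=.
case/or3P=> [-> //|/andP[/eqP ux vb]|/andP[/eqP bx _]].
  rewrite /o ux eqxx; case: (nbr vb) ub => ->; rewrite ?eqxx ?orbT //.
  by rewrite ux eqxx.
by rewrite bx in ub *; rewrite /o (negPf ub) eqxx orbT.
Qed.

End Suppress.

(** An isolated vertex is deleted, any other is contracted into a neighbour. The minor clause
    quantifies over [G0] so that steps can be chained. *)
Lemma suppress_vertex S G l v : nonneg_sym l -> v \in verts G -> v \notin S ->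
  (degree G v <= 2)%N ->
  exists H l', [/\ forall G0, minor_wrt S G0 G -> minor_wrt S G0 H,
    nonneg_sym l', forall u u', u \in S -> u' \in S -> dist H l' u u' = dist G l u u',
    forall u, (degree H u <= degree G u)%N & (#|verts H| < #|verts G|)%N].
Proof.
move=> nl vG vS dv.
have ltv : (#|verts G :\ v| < #|verts G|)%N by rewrite [ltnRHS](cardsD1 v) vG.
have el : edge_lengths G l by exact: nonneg_sym_edge_lengths.
have [[x vx]|iso] := pselect (exists x, adj G v x); last first.
  have sub : subrel (adj (del_vertex G v)) (adj G) by move=> a b /and3P[].
  have sup : subrel (adj G) (adj (del_vertex G v)).
    move=> a b ab; rewrite /= /del_vertex_adj ab /=; apply/andP; split.
      by apply/eqP => av; case: iso; exists b; rewrite -av.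
    by apply/eqP => bv; case: iso; exists a; rewrite -bv adj_sym.
  exists (del_vertex G v), l; split=> //.
  - by move=> G0 mG; exact: minor_del_vertex.
  - by move=> u u'; apply: dist_eq => //; exact: sub_dominated.
  by move=> u; apply/subset_leq_card/fintype.subsetP => y; rewrite !inE => /sub.
have [z vz nbr] : exists2 z, adj G v z & forall y, adj G v y -> y = x \/ y = z.
  have [[z [vz zx]]|no] := pselect (exists z, adj G v z /\ z != x).
    exists z => // y vy; have [->|yx] := eqVneq y x; first by left.
    right; apply/eqP; apply: contraTT dv => yz; rewrite -ltnNge.
    by apply/card_gt2P; exists x, y, z; rewrite !inE vx vy vz eq_sym yx yz zx.
  exists x => // y vy; have [->|yx] := eqVneq y x; first by left.
  by case: no; exists y.
exists (Defs.contract G x v), (suppress_length G l v x z); split=> //.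
- by move=> G0 mG; apply: minor_contract; rewrite // adj_sym.
- exact: suppress_length_nonneg_sym.
- move=> u u'; apply: dist_eq => //.
  + exact/nonneg_sym_edge_lengths/suppress_length_nonneg_sym.
  + exact: suppress_dominated.
  + exact: dominated_suppress.
move=> u; exact: degree_contract vx nbr u.
Qed.

(** Suppression raises no degree, so it creates no branching vertex. When it stops, every vertex is
    a terminal or branching. *)
Lemma eliminate S G H l : nonneg_sym l -> minor_wrt S G H ->
  exists G' l', [/\ minor_wrt S G G', edge_lengths G' l',
    forall u v, u \in S -> v \in S -> dist G' l' u v = dist H l u v &
    (#|verts G'| <= #|S| + #|[set v | v \notin S & 2 < degree H v]|)%N].
Proof.
have [n] := ubnP #|verts H|; elim: n H l => // n IH H l ltn nl mH.
have [[v [vH vS dv]]|no] := pselect (exists v,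
    [/\ v \in verts H, v \notin S & (degree H v <= 2)%N]).
  have [H' [l' [mH' nl' dist' deg' lt']]] := suppress_vertex nl vH vS dv.
  have [|G' [l'' [mG' el'' dist'' le]]] := IH H' l' _ nl' (mH' _ mH).
    exact: leq_trans lt' _.
  exists G', l''; split=> //; first by move=> a b aS bS; rewrite dist'' // dist'.
  apply: leq_trans le _; rewrite leq_add2l; apply/subset_leq_card/fintype.subsetP.
  by move=> u; rewrite !inE => /andP[-> /= d]; apply: leq_trans d _.
exists H, l; split=> //.
apply: leq_trans (leq_card_setU _ _).1; apply/subset_leq_card/fintype.subsetP.
move=> v vH; rewrite !inE; have [//|vS /=] := boolP (v \in S).
by rewrite ltnNge; apply/negP => dv; apply: no; exists v.
Qed.

End Elimination.

(** * The bound in terms of treewidth *)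

Lemma width_distance_preserving_minor (R : realType) (V : finType)
    (G : sgraph V) (ell : V -> V -> R) (S : {set V}) (p q : nat) :
  (1 <= p)%N -> has_decomposition_of_width G q -> (q <= p)%N ->
  edge_lengths G ell -> S \subset verts G ->
  exists (G' : sgraph V) (ell' : V -> V -> R),
    distance_preserving_minor S G ell G' ell' /\
    (#|verts G'| <= 8 * 2403 * p ^ 3 * #|S|)%N.
Proof.
move=> p1 [I [T [B [[[_ _ Tac] Bsub cov edge sub] wq]]]] qp el SG.
(* Lengths are set to zero off the edges, which makes them symmetric and nonnegative everywhere
   without affecting walks. *)
pose l x y := if adj G x y then ell x y else 0.
have nl : nonneg_sym l.
  move=> a b; rewrite /l [adj G b a]adj_sym; case: ifP => // ab.
  by have [-> ?] := el _ _ ab.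
have l_ell x s : path (adj G) x s -> path_length l x s = path_length ell x s.
  by elim: s x => //= y s IH x /andP[xy /IH->]; rewrite /l xy.
have bag_le i : i \in verts T -> (#|B i| <= p.+1)%N.
  move=> iT; apply: leq_trans (leq_bigmax_cond (F := fun i => #|B i|) i iT) _.
  by move: qp; rewrite -wq /width; case: (\max_(_ in _) _)%N.
have conn x : connected_on (adj T) [set i in verts T | x \in B i].
  have [/sub//|xG] := boolP (x \in verts G).
  move=> i j; rewrite inE => /andP[iT xi].
  by rewrite (fintype.subsetP (Bsub _ iT)) in xG.
have SB : S \subset bags B (verts T).
  apply/fintype.subsetP => x /(fintype.subsetP SG)/cov[i iT xi].
  by apply/bigcupP; exists i.
have [f [sf fG df cf]] := sparse_subgraph_treewidth (fun a b => (nl a b).1)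
  (fun a b => (nl a b).2) (ltn0Sn p) (@adj_sym _ T) Tac bag_le conn
  (@adj_sym _ G) SB edge.
have [H mH adjH] := minor_subgraph S sf fG.
have [G' [l' [mG' el' dist' le]]] := eliminate nl mH.
exists G', l'; split.
  split=> // u v uS vS; rewrite dist' //.
  have sfH : subrel f (adj H) by move=> a b; rewrite adjH.
  have sHG : subrel (adj H) (adj G) by move=> a b; rewrite adjH => /fG.
  have ell_l : dominated S (adj G) ell (adj G) l.
    by move=> a b s _ _ ws; exists s; rewrite // l_ell //; case/andP: ws.
  have l_ell' : dominated S (adj G) l (adj G) ell.
    by move=> a b s _ _ ws; exists s; rewrite // l_ell //; case/andP: ws.
  apply: (dist_eq (S := S)) => //.
    apply: dominated_trans ell_l _; apply: dominated_trans df _.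
    exact: sub_dominated.
  by apply: dominated_trans l_ell'; exact: sub_dominated.
have E : [set v | v \notin S & 2 < degree H v]%N =
    [set v | v \notin S & 2 < #|[set y | f v y]|]%N.
  apply/finset.setP => v; rewrite !inE /degree; congr (_ && (_ < _)%N).
  by apply: eq_card => y; rewrite !inE adjH.
rewrite {}E in le; apply: leq_trans le _; apply: leq_trans (leq_add (leqnn _) cf) _.
(* Bags have at most [p + 1 <= 2 * p] vertices, whence the factor 8; 2403 is 2402 plus one for the
   terminals themselves. *)
have p3 : (p.+1 ^ 3 <= 8 * p ^ 3)%N.
  by rewrite -[8%N]/(2 ^ 3)%N -expnMn leq_exp2r //; lia.
have p0 : (0 < p ^ 3)%N by rewrite expn_gt0 p1.
rewrite -{1}[#|S|]mul1n -mulnDl leq_mul2r; apply/orP; right.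
by move: (p.+1 ^ 3)%N (p ^ 3)%N p3 p0 => a b; lia.
Qed.

Theorem theorem7 (R : realType) :
  exists C : R, 0 < C /\
    forall p : nat, (1 <= p)%N ->
      (forall (V : finType) (G : sgraph V) (ell : V -> V -> R) (S : {set V})
              (k : nat),
         is_treewidth G p -> edge_lengths G ell ->
         S \subset verts G -> #|S| = k ->
         exists (G' : sgraph V) (ell' : V -> V -> R),
           distance_preserving_minor S G ell G' ell' /\
           #|verts G'|%:R <= C * p%:R ^+ 3 * k%:R) /\
      (forall k : nat, exists n : nat,
         is_fstar R k (TW p) n /\ n%:R <= C * p%:R ^+ 3 * k%:R).
Proof.
exists (8 * 2403)%:R; split=> [|p p1]; first by rewrite ltr0n.
have cast (n k : nat) : (n <= 8 * 2403 * p ^ 3 * k)%N ->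
    n%:R <= (8 * 2403)%:R * p%:R ^+ 3 * k%:R :> R.
  by rewrite -natrX -!natrM ler_nat.
split=> [V G ell S k [dec _] el SG Sk|k].
  have [G' [l' [dpm le]]] := width_distance_preserving_minor p1 dec (leqnn p) el SG.
  by exists G', l'; split=> //; rewrite cast // -Sk.
have bound : dpm_bound R k (TW p) (8 * 2403 * p ^ 3 * k)%N.
  move=> V G ell S [q [dec _] qp] el SG <-.
  exact: width_distance_preserving_minor dec qp el SG.
(* The minimum defining f^* exists because some natural number is a valid bound. *)
have ex : exists n, asbool (dpm_bound R k (TW p) n).
  by exists (8 * 2403 * p ^ 3 * k)%N; apply/asboolP.
case: (ex_minnP ex) => n /asboolP bn min; exists n; split.
  by split=> // m /asboolP; exact: min.
by apply: cast; apply: min; apply/asboolP.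
Qed.
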